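(* Let $\mathcal{D}$ be a distribution supported on $[0,1]$, let $0<p_1<p_2<\cdots<p_T\le1$, set $p_{T+1}=1$, and let $Q_t=\sup\{y:\Pr_{x\sim\mathcal{D}}(x\le y)\le p_t\}$ for $t=1,\dots,T$. Define generalized binomial voting as the scoring rule in which each voter gives the alternative she ranks in position $k$ the score $$s_k=\sum_{t=1}^T Q_t\left(\sum_{\ell=k}^m\binom{m}{\ell}(1-p_t)^\ell p_t^{m-\ell}-\sum_{\ell=k}^m\binom{m}{\ell}(1-p_{t+1})^\ell p_{t+1}^{m-\ell}\right),$$ selecting an alternative with the largest total score (ties broken arbitrarily). Then for all $n,m$ and every preference profile $\sigma$, the selected alternative $g(\sigma)$ satisfies $\mathbb{E}[\mathrm{sw}(g(\sigma),u)]\ge\beta\max_{j\in A}\mathbb{E}[\mathrm{sw}(j,u)]$ with $\beta=\sum_{s=1}^T Q_s(p_{s+1}-p_s)$.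
   Context: There are $n$ voters and $m$ alternatives $A=\{1,\dots,m\}$. A preference profile $\sigma$ consists of a ranking of $A$ for each voter; position $1$ is the top. Given $\mathcal{D}$ and $\sigma$, a random utility profile $u$ consistent with $\sigma$ is generated as follows: independently for each voter $i$, draw $m$ i.i.d. samples from $\mathcal{D}$ and assign them, from highest to lowest, to the alternatives in the order of voter $i$'s ranking. The social welfare of $j$ is $\mathrm{sw}(j,u)=\sum_i u_{ij}$; expectations are over $u$. *)

(* Defs.v *)
From HB Require Import structures.
From mathcomp Require Import all_boot all_order all_algebra all_fingroup.
From mathcomp Require Import all_classical all_reals all_analysis.
Set Implicit Arguments. Unset Strict Implicit. Unset Printing Implicit Defensive.
Import Order.TTheory GRing.Theory Num.Theory.
Local Open Scope classical_set_scope.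
Local Open Scope ring_scope.

(* Mutual independence of a finite family of real random variables:
   product rule for every family of measurable sets (taking B i = setT
   gives the rule for every subfamily). *)
Definition mutually_independent {d} {T : measurableType d} {R : realType}
  (P : probability T R) {I : finType} (X : I -> T -> R) : Prop :=
  forall B : I -> set R, (forall i, measurable (B i)) ->
    P (\bigcap_(i in [set: I]) (X i @^-1` B i)) =
    (\prod_(i : I) P (X i @^-1` B i))%E.

Definition has_law {d} {T : measurableType d} {R : realType}
  (P : probability T R) (D : probability R R) (Y : T -> R) : Prop :=
  forall B : set R, measurable B -> P (Y @^-1` B) = D B.

(* k-th largest (0-indexed: k = 0 is the largest) of m reals x 0, ..., x (m-1). *)
Definition kth_largest {R : realType} {m : nat} (x : 'I_m -> R) (k : nat) : R :=
  nth 0 (sort >=%R [seq x i | i <- enum 'I_m]) k.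

(* Social welfare of alternative j in the random utility profile built from the
   samples X (i, k) (sample k of voter i) and the profile sigma, where
   sigma i j is the 0-indexed position of alternative j in voter i's ranking:
   voter i's utility for j is the (sigma i j)-th largest of her m samples. *)
Definition sw {d} {T : measurableType d} {R : realType} {n m : nat}
  (X : 'I_n * 'I_m -> T -> R) (sigma : 'I_n -> {perm 'I_m}) (j : 'I_m) : T -> R :=
  fun w => \sum_(i < n) kth_largest (fun k => X (i, k) w) (sigma i j).

Definition quantileQ {R : realType} (D : probability R R) (pt : R) : R :=
  sup [set y : R | (D [set x : R | (x <= y)%R] <= pt%:E)%E].

Definition pext {R : realType} (T : nat) (p : nat -> R) (t : nat) : R :=
  if (t <= T)%N then p t else 1.

Definition binom_tail {R : realType} (m : nat) (q : R) (k : nat) : R :=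
  \sum_(k <= l < m.+1) ('C(m, l))%:R * (1 - q) ^+ l * q ^+ (m - l).

(* score s_k of the (1-indexed) position k under generalized binomial voting *)
Definition gbv_score {R : realType} (D : probability R R) (T : nat) (p : nat -> R)
  (m k : nat) : R :=
  \sum_(1 <= t < T.+1) quantileQ D (pext T p t) *
     (binom_tail m (pext T p t) k - binom_tail m (pext T p t.+1) k).

(* total score of alternative j: voter i ranks j in (1-indexed) position (sigma i j).+1 *)
Definition gbv_total {R : realType} (D : probability R R) (T : nat) (p : nat -> R)
  {n m : nat} (sigma : 'I_n -> {perm 'I_m}) (j : 'I_m) : R :=
  \sum_(i < n) gbv_score D T p m (sigma i j).+1.

Definition gbv_beta {R : realType} (D : probability R R) (T : nat) (p : nat -> R) : R :=
  \sum_(1 <= s < T.+1) quantileQ D (pext T p s) * (pext T p s.+1 - pext T p s).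

(* Main.v *)
Require Import Defs.
From HB Require Import structures.
From mathcomp Require Import all_boot all_order all_algebra all_fingroup.
From mathcomp Require Import all_classical all_reals all_analysis.
From mathcomp Require Import measurable_realfun.
From mathcomp Require Import ring lra.
Import Order.TTheory GRing.Theory Num.Theory.
Local Open Scope classical_set_scope.
Local Open Scope ring_scope.

(* Utilities lie in [0, 1], so no alternative has expected welfare above [n];
   it suffices that the winner's is at least [n * beta].  The scores satisfy
   [s_1 + ... + s_m = m * beta], because the tails [P(Bin(m, 1-q) >= k)] sum over
   [k] to [m (1-q)]; averaging over the alternatives, the winner's total score is
   at least [n * beta].  Finally [s_k] is at most the expectation of the [k]-th
   largest sample [Y]: by Abel summation [s_k] is the sum over [t] of
   [(Q_t - Q_(t-1)) * P(Bin(m, 1-p_t) >= k)], whereas [Y] dominates the sum of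
   [(Q_t - Q_(t-1)) * 1(Q_t <= Y)], and [P(Q_t <= Y)] is a binomial tail with
   success probability at least [1 - p_t]. *)

(** * Order statistics of a finite family *)

Lemma sorted_le_nth (R : realType) (s : seq R) (k : nat) (y : R) :
  sorted >=%R s -> (k < size s)%N ->
  (y <= nth 0 s k) = (k < count (fun z => (y <= z)%R) s)%N.
Proof.
elim: s k => // a s IHs k /= sorted_s k_lt.
have all_le : all (>=%R a) s by apply: order_path_min sorted_s => x z t xz zt; exact: le_trans zt xz.
have [ya|ay] := leP y a.
  case: k k_lt => [|k] k_lt /=; first by rewrite ya.
  by rewrite add1n ltnS IHs // (path_sorted sorted_s).
have lt_y z : z \in s -> (y <= z) = false.
  by move=> /(allP all_le) /= za; apply/negbTE; rewrite -ltNge (le_lt_trans za).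
rewrite add0n (_ : count _ s = 0)%N; last first.
  by apply/eqP; rewrite -leqn0 leqNgt -has_count; apply/hasPn => z /lt_y ->.
case: k k_lt => [|k] k_lt /=; first by rewrite leNgt ay.
by rewrite lt_y // mem_nth.
Qed.

(** Turns an event about an order statistic into a count of samples, whose law is binomial. The
    inequality on the right is strict because [k] is 0-indexed. *)
Lemma le_kth_largest (R : realType) (m : nat) (x : 'I_m -> R) (k : nat) (y : R) :
  (k < m)%N ->
  (y <= kth_largest x k) = (k < #|[set i | (y <= x i)%R]%SET|)%N.
Proof.
move=> km; rewrite /kth_largest sorted_le_nth; last 2 first.
- by apply: sort_sorted => a b; exact: le_total.
- by rewrite size_sort size_map size_enum_ord.
rewrite (seq.permP (permEl (perm_sort _ _))) count_map cardE size_filter -enumT.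
by congr (_ < _)%N; apply: eq_count => i /=; rewrite inE.
Qed.

(** * Tails of the binomial distribution with failure probability [q] *)

Lemma binom_tail0 (R : realType) (m : nat) (q : R) : binom_tail m q 0 = 1.
Proof.
transitivity ((q + (1 - q)) ^+ m); last by rewrite subrKC expr1n.
rewrite /binom_tail big_mkord exprDn; apply: eq_bigr => i _.
by rewrite -mulrA mulr_natl mulrC.
Qed.

Lemma binom_tail_out (R : realType) (m : nat) (q : R) : binom_tail m q m.+1 = 0.
Proof. by rewrite /binom_tail big_geq. Qed.

Lemma binom_tail1 (R : realType) (m k : nat) : binom_tail m (1 : R) k.+1 = 0.
Proof.
rewrite /binom_tail big_nat big1 // => l /andP[kl _].
by rewrite subrr expr0n gtn_eqF ?(leq_ltn_trans _ kl)// mulr0 mul0r.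
Qed.

(** Condition on one of the [m.+1] trials: a success leaves [k] successes to reach, a failure leaves
    [k.+1]. Algebraically this is Pascal's rule. *)
Lemma binom_tailS (R : realType) (m k : nat) (q : R) : (k <= m)%N ->
  binom_tail m.+1 q k.+1 =
  (1 - q) * binom_tail m q k + q * binom_tail m q k.+1.
Proof.
move=> km; rewrite /binom_tail big_add1 /= mulr_sumr.
rewrite -[X in q * X](_ : \sum_(k.+1 <= l < m.+2)
    ('C(m, l))%:R * (1 - q) ^+ l * q ^+ (m - l) = _); last first.
  by rewrite big_nat_recr //= bin_small // !mul0r addr0.
rewrite [X in q * X]big_add1 /= mulr_sumr -big_split /= big_nat [RHS]big_nat.
apply: eq_bigr => l /andP[_]; rewrite ltnS => lm.
rewrite binS natrD subSS exprS.
(* At [l = m] the truncated exponent [m - l.+1] is off by one, but its coefficient ['C(m, m.+1)] is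
   zero. *)
move: lm; rewrite leq_eqVlt => /predU1P[->|lm].
  by rewrite bin_small // subnn; ring.
rewrite -(subnSK lm) exprS; ring.
Qed.

Lemma binom_tail_ge0 (R : realType) (m k : nat) (q : R) : 0 <= q <= 1 ->
  0 <= binom_tail m q k.
Proof.
move=> /andP[q0 q1]; apply: sumr_ge0 => l _.
by rewrite !mulr_ge0 ?exprn_ge0 ?subr_ge0.
Qed.

Lemma binom_tail_anti (R : realType) (m k : nat) (q : R) : 0 <= q <= 1 ->
  binom_tail m q k.+1 <= binom_tail m q k.
Proof.
move=> /andP[q0 q1]; have [km|mk] := ltnP k m.+1; last first.
  by rewrite /binom_tail !big_geq // ltnW.
rewrite [leRHS]/binom_tail big_ltn // lerDr.
by rewrite !mulr_ge0 ?exprn_ge0 ?subr_ge0.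
Qed.

(** By [binom_tailS] both sides are convex combinations of two tails. Passing from [q] to [r] lowers
    both tails by induction and shifts weight to the smaller one. *)
Lemma le_binom_tail (R : realType) (m k : nat) (q r : R) :
  0 <= q -> q <= r -> r <= 1 -> binom_tail m r k <= binom_tail m q k.
Proof.
move=> q0 qr r1.
elim: m k => [|m IHm] [|k]; rewrite ?binom_tail0 //.
  by rewrite /binom_tail !big_geq.
have [km|mk] := leqP k m; last by rewrite /binom_tail !big_geq.
rewrite !binom_tailS //.
have := IHm k; have := IHm k.+1.
have /(binom_tail_anti _ m k) : 0 <= q <= 1 by rewrite q0 (le_trans qr).
move: (binom_tail m q k) (binom_tail m q k.+1) (binom_tail m r k) (binom_tail m r k.+1).
move=> a b c d; nra.
Qed.

(** The tail-sum formula for a binomial mean. By [binom_tailS] an extra trial adds [1 - q], which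
    comes from the tail at 0. *)
Lemma sum_binom_tail (R : realType) (m : nat) (q : R) :
  \sum_(k < m) binom_tail m q k.+1 = m%:R * (1 - q).
Proof.
elim: m => [|m IHm]; first by rewrite big_ord0 mul0r.
rewrite (eq_bigr (fun k : 'I_m.+1 =>
    (1 - q) * binom_tail m q k + q * binom_tail m q k.+1)); last first.
  by move=> k _; rewrite binom_tailS // -ltnS.
rewrite big_split /= -!mulr_sumr big_ord_recl binom_tail0 /=.
rewrite [X in q * X]big_ord_recr /= binom_tail_out.
rewrite (eq_bigr (fun k : 'I_m => binom_tail m q k.+1)) // IHm -natr1; ring.
Qed.

(** * Staircase sums *)

Lemma abel_sum (R : realType) (Q b : nat -> R) (T : nat) :
  Q 0%N = 0 ->
  \sum_(1 <= t < T.+1) Q t * (b t - b t.+1) =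
  \sum_(t < T) (Q t.+1 - Q t) * b t.+1 - Q T * b T.+1.
Proof.
move=> Q0; elim: T => [|T IHT].
  by rewrite big_geq // big_ord0 Q0 mul0r subr0.
by rewrite big_nat_recr //= IHT big_ord_recr /=; ring.
Qed.

(** By monotonicity the indicators select an initial run of steps, so the sum telescopes to the
    highest level not above [v]. *)
Lemma sum_steps_le (R : realType) (Q : nat -> R) (v : R) (T : nat) :
  Q 0%N = 0 -> {homo Q : s t / (s <= t)%N >-> (s <= t)%R} -> 0 <= v ->
  \sum_(t < T) (Q t.+1 - Q t) * (Q t.+1 <= v)%R%:R <= v.
Proof.
move=> Q0 Qh v0; elim: T => [|T IHT]; first by rewrite big_ord0.
rewrite big_ord_recr /=; have [QT|] := leP (Q T.+1) v; last by rewrite mulr0 addr0.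
rewrite (_ : \sum_(t < T) _ = Q T) ?mulr1 ?subrKC //.
rewrite -[RHS]subr0 -[in RHS]Q0 -telescope_sumr // big_mkord.
apply: eq_bigr => t _.
by rewrite (le_trans _ QT) ?mulr1 // Qh // ltnS ltnW.
Qed.

(** * Independence and the law of the number of hits *)

Lemma mutually_independent_inj d (T : measurableType d) (R : realType)
    (P : probability T R) (I J : finType) (X : I -> T -> R) (h : J -> I) :
  injective h -> mutually_independent P X ->
  mutually_independent P (X \o h).
Proof.
move=> h_inj indX B mB.
(* The intersection has one member when [i] is in the image of [h], and none otherwise, which yields
   [setT]. *)
pose B' i := \bigcap_(j in [set j | h j = i]) B j.
have B'h j : B' (h j) = B j.
  apply/seteqP; split=> [x /(_ j erefl)//|x Bx k /h_inj ->//].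
have B'T i : i \notin codom h -> B' i = setT.
  move=> hi; apply/seteqP; split=> // x _ j hj.
  by move: hi; rewrite -hj codom_f.
have mB' i : measurable (B' i) by apply: fin_bigcap_measurable.
have := indX B' mB'.
rewrite (_ : \bigcap_(i in _) _ = \bigcap_(j in [set: J]) ((X \o h) j @^-1` B j)).
  move=> ->; rewrite (bigID (mem (codom h))) /= [X in (_ * X)%E]big1 ?mule1.
    rewrite -big_uniq /=; last by rewrite codomE map_inj_uniq ?enum_uniq.
    rewrite codomE big_map big_enum.
    by apply: eq_bigr => j _; rewrite B'h.
  by move=> i /B'T ->; rewrite preimage_setT probability_setT.
apply/seteqP; split=> w Xw.
  by move=> j _; have := Xw (h j) Logic.I; rewrite /preimage /= B'h.
by move=> i _ j <-; exact: Xw.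
Qed.

(** The event splits into the disjoint events [E S] that the samples hitting [B] are exactly those
    in [S]; independence gives each a product probability. *)
Lemma count_hits_law d (T : measurableType d) (R : realType)
    (P : probability T R) (D : probability R R) (m k : nat)
    (X : 'I_m -> {RV P >-> R}) (B : set R) :
  mutually_independent P (fun i => X i : T -> R) ->
  (forall i, has_law P D (X i)) -> measurable B ->
  P [set w | (k <= #|[set i | X i w \in B]%SET|)%N] =
  (binom_tail m (1 - fine (D B)) k)%:E.
Proof.
move=> indX lawX mB.
pose E (S : {set 'I_m}) := \bigcap_(i in [set: 'I_m])
  (X i @^-1` (if i \in S then B else ~` B)).
have mI (S : {set 'I_m}) i : measurable (if i \in S then B else ~` B).
  by case: ifP => // _; exact: measurableC.
have mE S : measurable (E S).
  apply: fin_bigcap_measurable => // i _.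
  by rewrite -[_ @^-1` _]setTI; exact: measurable_funPT.
have E_iff S w : E S w <-> [set i | X i w \in B]%SET = S.
  split=> [Ew|<- i _ /=]; last first.
    by rewrite inE; case: ifPn => /=; [rewrite inE|rewrite notin_setE].
  apply/setP => i; rewrite inE; have := Ew i I; rewrite /preimage /=.
  by case: ifPn => _ => [/mem_set//|h]; apply/negbTE; rewrite notin_setE.
have PE S : P (E S) = (fine (D B) ^+ #|S| * (1 - fine (D B)) ^+ (m - #|S|))%:E.
  rewrite /E indX//.
  rewrite (eq_bigr (fun i => (if i \in S then fine (D B) else 1 - fine (D B))%:E)).
    rewrite prodEFin (bigID (mem S)) /=; congr (_ * _)%:E.
      by rewrite (eq_bigr (fun=> fine (D B))) => [|i ->//]; rewrite prodr_const.
    rewrite (eq_bigr (fun=> 1 - fine (D B))) => [|i /negbTE ->//].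
    rewrite prodr_const; congr (_ ^+ _).
    rewrite -[X in (X - _)%N](card_ord m) -(cardC (mem S)) addKn.
    exact: eq_card.
  move=> i _; rewrite [LHS]lawX//; case: ifP => _; first by rewrite fineK ?fin_num_measure.
  by rewrite probability_setC// EFinB fineK ?fin_num_measure.
pose r := enum [pred S : {set 'I_m} | (k <= #|S|)%N].
have -> : [set w | (k <= #|[set i | X i w \in B]%SET|)%N] = \bigcup_(S in [set` r]) E S.
  apply/seteqP; split=> [w /= kw|w [S]].
    by exists [set i | X i w \in B]%SET; [rewrite /= mem_enum|exact/E_iff].
  by rewrite /= mem_enum => kS /E_iff ->.
rewrite measure_fin_bigcup //; last first.
  by move=> S S' _ _ [w [/E_iff <- /E_iff <-]].
rewrite -fsbig_seq ?enum_uniq// (eq_bigr _ (fun S _ => PE S)) sumEFin; congr _%:E.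
rewrite big_enum_cond /=.
(* Group the hit sets by cardinality; [inord] loses nothing since [#|S|] is at most [m]. *)
rewrite (partition_big (fun S : {set 'I_m} => inord #|S| : 'I_m.+1) xpredT) //=.
rewrite /binom_tail (big_nat_widenl _ 0)// [in RHS]big_mkord [RHS]big_mkcond /=.
apply: eq_bigr => l _.
rewrite (eq_bigl (fun S : {set 'I_m} =>
    (k <= l)%N && (S \in [set S : {set 'I_m} | #|S| == l]%SET))); last first.
  move=> S; rewrite !inE andbT.
  have -> : (inord #|S| == l) = (#|S| == l).
    by rewrite -val_eqE /= inordK // ltnS -[X in (_ <= X)%N]card_ord max_card.
  by case: eqP => [->|]; rewrite ?andbF.
case: (k <= l)%N; last by rewrite big_pred0.
rewrite (eq_bigr (fun=> fine (D B) ^+ l * (1 - fine (D B)) ^+ (m - l))).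
  by rewrite sumr_const card_draws card_ord subKr -[LHS]mulr_natl mulrA.
by move=> S; rewrite inE => /eqP ->.
Qed.

(** * Measurability and expectations *)

Lemma measurable_kth_largest d (T : measurableType d) (R : realType) (m k : nat)
    (X : 'I_m -> T -> R) : (k < m)%N ->
  (forall i, measurable_fun setT (X i)) ->
  measurable_fun setT (fun w => kth_largest (fun i => X i w) k).
Proof.
move=> km mX.
apply: (measurability (@RGenCInfty.G R)) => [|/= _ [_] [y] -> <-].
  exact: RGenCInfty.measurableE.
rewrite setTI.
have -> : (fun w => kth_largest (fun i => X i w) k) @^-1` `[y, +oo[%classic =
  \bigcup_(S in [set S : {set 'I_m} | (k < #|S|)%N])
    \bigcap_(i in [set i | i \in S]) (X i @^-1` `[y, +oo[%classic).
  apply/seteqP; split=> w /=; rewrite in_itv/= andbT le_kth_largest //.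
    move=> kS; exists [set i | y <= X i w]%SET => //= i.
    by rewrite /= inE in_itv/= andbT.
  move=> [S /= kS] SX; apply: leq_trans kS _; apply: subset_leq_card.
  by apply/fintype.subsetP => i /SX; rewrite /preimage /= in_itv /= andbT inE.
apply: fin_bigcup_measurable => // S _; apply: fin_bigcap_measurable => // i _.
by rewrite -[_ @^-1` _]setTI; exact: mX.
Qed.

Lemma expectation_ae_le d (T : measurableType d) (R : realType)
    (P : probability T R) (X Y : T -> R) :
  measurable_fun setT X -> measurable_fun setT Y ->
  {ae P, forall w, 0 <= X w} -> {ae P, forall w, X w <= Y w} ->
  ('E_P[X] <= 'E_P[Y])%E.
Proof.
move=> mX mY X0 XY.
(* Nonnegativity holds only almost surely; truncation at 0 makes it hold everywhere, as
   [expectation_le] demands, without changing the expectation. *)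
have maxE (Z : T -> R) : measurable_fun setT Z -> {ae P, forall w, 0 <= Z w} ->
    measurable_fun setT (fun w => Num.max (Z w) 0) /\
    ('E_P[Z] = 'E_P[(fun w => Num.max (Z w) 0)%R])%E.
  move=> mZ Z0; have mZ0 : measurable_fun setT (fun w => Num.max (Z w) 0).
    exact: measurable_maxr.
  split=> //; rewrite unlock; apply: ae_eq_integral => //.
  - exact/measurable_EFinP.
  - exact/measurable_EFinP.
  - by apply: filterS Z0 => w Zw _; rewrite max_l.
have Y0 : {ae P, forall w, 0 <= Y w}.
  by apply: filterS2 X0 XY => w; exact: le_trans.
have [mX' ->] := maxE X mX X0; have [mY' ->] := maxE Y mY Y0.
apply: expectation_le => //.
- by move=> w; rewrite le_max lexx orbT.
- by move=> w; rewrite le_max lexx orbT.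
- by apply: filterS XY => w XYw; rewrite ge_max !le_max XYw lexx orbT.
Qed.

Lemma expectation_sum_indic d (T : measurableType d) (R : realType)
    (P : probability T R) (I : Type) (s : seq I) (c : I -> R) (A : I -> set T) :
  (forall i, 0 <= c i) -> (forall i, measurable (A i)) ->
  ('E_P[(fun w => \sum_(i <- s) c i * \1_(A i) w)%R] =
   \sum_(i <- s) (c i)%:E * P (A i))%E.
Proof.
move=> c0 mA; rewrite unlock.
under eq_integral do rewrite -sumEFin.
rewrite ge0_integral_sum //.
- apply: eq_bigr => i _; under eq_integral do rewrite EFinM.
  rewrite ge0_integralZl_EFin //.
  + by rewrite integral_indic // setIT.
  + exact/measurable_EFinP.
- move=> i; apply/measurable_EFinP; exact: measurable_funM.
- by move=> i w _; rewrite lee_fin mulr_ge0.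
Qed.

Lemma measurable_superlevel d (T : measurableType d) (R : realType) (X : T -> R) (y : R) :
  measurable_fun setT X -> measurable [set w | y <= X w].
Proof.
move=> mX.
suff <- : setT `&` X @^-1` `[y, +oo[%classic = [set w | y <= X w] by exact: mX.
by rewrite setTI; apply/seteqP; split=> w /=; rewrite in_itv /= andbT.
Qed.

(** * Quantiles of a distribution on the unit interval *)

Section quantile.
Context (R : realType) (D : probability R R).
Hypothesis D01 : D [set x : R | 0 <= x <= 1] = 1%E.

Let mle (y : R) : measurable [set x : R | (x <= y)%R].
Proof.
suff <- : `]-oo, y]%classic = [set x : R | (x <= y)%R] by [].
by apply/seteqP; split=> x /=; rewrite in_itv.
Qed.

Let m01 : measurable [set x : R | 0 <= x <= 1].
Proof.
suff <- : `[0, 1]%classic = [set x : R | 0 <= x <= 1] by [].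
by apply/seteqP; split=> x /=; rewrite in_itv.
Qed.

Lemma cdf_lt0 (y : R) : y < 0 -> D [set x : R | (x <= y)%R] = 0%E.
Proof.
move=> y0; apply/eqP; rewrite -measure_le0.
have <- : D (~` [set x : R | 0 <= x <= 1]) = 0%E by rewrite probability_setC// D01 subee.
apply: le_measure; rewrite ?inE//; first exact: measurableC.
by move=> x /= xy; apply/negP; rewrite negb_and -ltNge (le_lt_trans xy).
Qed.

Lemma cdf_ge1 (y : R) : 1 <= y -> D [set x : R | (x <= y)%R] = 1%E.
Proof.
move=> y1; apply/eqP; rewrite eq_le probability_le1 //=; rewrite -[leLHS]D01.
by apply: le_measure; rewrite ?inE// => x /= /andP[_ x1]; exact: le_trans y1.
Qed.

Let below (q : R) := [set y : R | (D [set x : R | (x <= y)%R] <= q%:E)%E].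

Let below_lt0 (q y : R) : 0 <= q -> y < 0 -> below q y.
Proof. by move=> q0 y0; rewrite /below /= cdf_lt0. Qed.

Let below_ub (q : R) : q < 1 -> ubound (below q) 1.
Proof.
move=> q1 y; rewrite /below /=; have [//|/ltW y1] := leP y 1.
by rewrite cdf_ge1 // lee_fin leNgt q1.
Qed.

Let below_sup (q : R) : 0 <= q < 1 -> has_sup (below q).
Proof.
move=> /andP[q0 q1]; split; last by exists 1; exact: below_ub.
by exists (-1); apply: below_lt0; rewrite ?ltrN10.
Qed.

Lemma quantileQ_ge0 (q : R) : 0 <= q < 1 -> 0 <= quantileQ D q.
Proof.
move=> q01; rewrite leNgt; apply/negP => Q0.
(* If the supremum were negative, half of it would be a larger member of the set. *)
have : below q (quantileQ D q / 2) by apply: below_lt0; [case/andP: q01|lra].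
move=> /(sup_upper_bound (below_sup _ q01)); rewrite -/(quantileQ D q); lra.
Qed.

Lemma quantileQ_le1 (q : R) : 0 <= q < 1 -> quantileQ D q <= 1.
Proof.
move=> q01; apply: ge_sup; first exact: (below_sup _ q01).1.
by apply: below_ub; case/andP: q01.
Qed.

Lemma le_quantileQ (q r : R) : 0 <= q -> q <= r -> r < 1 ->
  quantileQ D q <= quantileQ D r.
Proof.
move=> q0 qr r1; apply: ge_sup; first by apply: (below_sup _ _).1; rewrite q0 (le_lt_trans qr).
move=> y yq; apply: sup_upper_bound; first by apply: below_sup; rewrite (le_trans q0).
by apply: le_trans yq _; rewrite lee_fin.
Qed.

(** Continuity from below: the open ray is the union of the closed rays [F n], each ending below
    some member of [below q]. The strict inequality excludes a possible atom at the quantile. *)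
Lemma cdf_lt_quantileQ (q : R) : 0 <= q < 1 ->
  (D [set x : R | (x < quantileQ D q)%R] <= q%:E)%E.
Proof.
move=> q01.
pose F (n : nat) := [set x : R | (x <= quantileQ D q - n.+1%:R^-1)%R].
have FE : [set x : R | (x < quantileQ D q)%R] = \bigcup_n F n.
  apply/seteqP; split=> [x /= /ltr_add_invr[k xk]|x [k _]].
    by exists k => //; rewrite /F /= lerBrDr ltW.
  by rewrite /F /= => /le_lt_trans -> //; rewrite ltrBlDr ltrDl.
have mF n : measurable (F n) by exact: mle.
have ndF : {homo F : n1 n2 / (n1 <= n2)%N >-> (n1 <= n2)%O}.
  move=> n1 n2 n12; apply/subsetPset => x; rewrite /F /= => /le_trans -> //.
  by rewrite lerB // lef_pV2 ?posrE// ler_nat.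
have cvgF := nondecreasing_cvg_mu (mu := D) mF (bigcup_measurable (fun n _ => mF n)) ndF.
rewrite FE; apply: (cvge_to_le cvgF).
apply: nearW => n /=.
have [y yq Qy] := @sup_adherent _ (below q) n.+1%:R^-1 ltac:(by []) (below_sup _ q01).
apply: le_trans yq; apply: le_measure; rewrite ?inE // => x; rewrite /F /= => xQ.
by apply: le_trans xQ _; exact: ltW.
Qed.

End quantile.

(** * Thresholds, cutoffs and scores *)

Section thresholds.
Context (R : realType) (D : probability R R) (T : nat) (p : nat -> R).
Hypothesis D01 : D [set x : R | 0 <= x <= 1] = 1%E.
Hypothesis p1_gt0 : 0 < p 1%N.
Hypothesis p_incr : forall t, (1 <= t)%N -> (t < T)%N -> p t < p t.+1.
Hypothesis pT_le1 : p T <= 1.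

Lemma threshold_le (s t : nat) : (1 <= s)%N -> (s <= t)%N -> (t <= T)%N -> p s <= p t.
Proof.
move=> s1; elim: t => [|t IHt]; first by case: s s1.
rewrite leq_eqVlt => /predU1P[-> //|st] tT.
by rewrite (le_trans (IHt st (ltnW tT))) // ltW // p_incr // (leq_trans s1).
Qed.

(** Stated at [t.+1] because [p 0] is unconstrained. *)
Lemma pext_bounds (t : nat) : 0 < pext T p t.+1 <= 1.
Proof.
rewrite /pext; case: ifP => tT; last by rewrite ltr01 lexx.
by rewrite (lt_le_trans p1_gt0) ?threshold_le //= (le_trans _ pT_le1) // threshold_le.
Qed.

Lemma pext_le (t : nat) : pext T p t.+1 <= pext T p t.+2.
Proof.
have [tT|Tt] := ltnP t.+1 T.
  by rewrite /pext (ltnW tT) tT threshold_le.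
by rewrite [leRHS]/pext leqNgt ltnS Tt /=; case/andP: (pext_bounds t).
Qed.

Lemma pext_last : pext T p T.+1 = 1.
Proof. by rewrite /pext ltnn. Qed.

(* At a threshold equal to [1] the set defining [quantileQ] is unbounded and its
   [sup] is the junk value [0]; [1] keeps the thresholds nondecreasing, and is
   harmless since the corresponding weights in the scores vanish. *)
Definition cutoff (t : nat) : R :=
  if t is 0%N then 0 else
  if pext T p t < 1 then quantileQ D (pext T p t) else 1.

Lemma cutoff_le1 (t : nat) : cutoff t <= 1.
Proof.
case: t => [|t] //=; case: ifPn => // t1; apply: quantileQ_le1 => //.
by rewrite t1; case/andP: (pext_bounds t) => /ltW ->.
Qed.

Lemma cutoff_homo : {homo cutoff : s t / (s <= t)%N >-> (s <= t)%R}.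
Proof.
apply: homo_leq => //; first exact: le_trans.
move=> [|t] /=.
  case: ifPn => // t1; apply: quantileQ_ge0 => //.
  by rewrite t1; case/andP: (pext_bounds 0) => /ltW ->.
have [t2|t2] := ltP (pext T p t.+2) 1.
  rewrite (le_lt_trans (pext_le t)) //; apply: le_quantileQ => //; last exact: pext_le.
  by case/andP: (pext_bounds t) => /ltW.
exact: (cutoff_le1 t.+1).
Qed.

(** Bounds the probability that a sample misses the cutoff. Missing means lying strictly below it,
    so [cdf_lt_quantileQ] applies; a threshold equal to 1 is trivial. *)
Lemma cutoff_mass (t : nat) :
  1 - fine (D [set x : R | cutoff t.+1 <= x]) <= pext T p t.+1.
Proof.
rewrite /=; case: ifPn => [t1|]; last first.
  rewrite -leNgt => /(le_trans _) -> //.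
  by rewrite gerBl fine_ge0.
set Q := quantileQ _ _.
have mQ : measurable [set x : R | Q <= x] by apply: (@measurable_superlevel _ R R id).
rewrite -lee_fin EFinB fineK ?fin_num_measure // -probability_setC //.
rewrite (_ : ~` _ = [set x : R | (x < Q)%R]).
  by apply: cdf_lt_quantileQ => //; rewrite t1; case/andP: (pext_bounds t) => /ltW ->.
by apply/seteqP; split=> x /=; rewrite ltNge => /negP.
Qed.

(** The two can differ only at a threshold equal to 1, where the weight [a] vanishes; this removes
    the junk value from scores and [gbv_beta]. *)
Lemma quantileQ_cutoff (a : nat -> R) (t : nat) : (pext T p t.+1 = 1 -> a t.+1 = 0) ->
  quantileQ D (pext T p t.+1) * a t.+1 = cutoff t.+1 * a t.+1.
Proof.
move=> a0 /=; case: ltP => // t1; rewrite a0 ?mulr0 //.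
by apply/eqP; rewrite eq_le t1; case/andP: (pext_bounds t) => _ ->.
Qed.

Lemma pext_eq1S (t : nat) : pext T p t.+1 = 1 -> pext T p t.+2 = 1.
Proof.
move=> t1; apply/eqP; rewrite eq_le -{2}t1 pext_le andbT.
by case/andP: (pext_bounds t.+1).
Qed.

Lemma gbv_scoreE (m k : nat) :
  gbv_score D T p m k.+1 =
  \sum_(t < T) (cutoff t.+1 - cutoff t) * binom_tail m (pext T p t.+1) k.+1.
Proof.
rewrite /gbv_score.
have := @abel_sum R cutoff (fun t => binom_tail m (pext T p t) k.+1) T erefl.
(* The boundary term of the Abel summation vanishes: at threshold 1 no trial succeeds. *)
rewrite pext_last binom_tail1 mulr0 subr0 => <-.
apply: eq_big_nat => -[|t] // _.
apply: (quantileQ_cutoff (fun t =>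
  binom_tail m (pext T p t) k.+1 - binom_tail m (pext T p t.+1) k.+1)).
by move=> t1; rewrite t1 (pext_eq1S _ t1) subrr.
Qed.

Lemma gbv_beta_ge0 : 0 <= gbv_beta D T p.
Proof.
rewrite /gbv_beta big_nat; apply: sumr_ge0 => -[|t] // _.
rewrite (quantileQ_cutoff (fun t => pext T p t.+1 - pext T p t)).
  by rewrite mulr_ge0 ?subr_ge0 ?pext_le // -[0]/(cutoff 0) cutoff_homo.
by move=> t1; rewrite t1 (pext_eq1S _ t1) subrr.
Qed.

Lemma sum_gbv_score (m : nat) :
  \sum_(k < m) gbv_score D T p m k.+1 = m%:R * gbv_beta D T p.
Proof.
rewrite exchange_big mulr_sumr; apply: eq_bigr => t _ /=.
rewrite -mulr_sumr sumrB !sum_binom_tail; ring.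
Qed.

(** A ranking is a permutation, so each voter hands out every score exactly once. *)
Lemma sum_gbv_total (n m : nat) (sigma : 'I_n -> {perm 'I_m}) :
  \sum_j gbv_total D T p sigma j = m%:R * (n%:R * gbv_beta D T p).
Proof.
rewrite exchange_big /=.
rewrite (eq_bigr (fun=> m%:R * gbv_beta D T p)).
  by rewrite sumr_const card_ord -mulr_natl; ring.
move=> i _; rewrite -sum_gbv_score.
by rewrite [RHS](reindex_inj (@perm_inj _ (sigma i))).
Qed.

(** A maximum is at least the average; [m] is positive because [g] exists. *)
Lemma gbv_total_max_ge (n m : nat) (sigma : 'I_n -> {perm 'I_m}) (g : 'I_m) :
  (forall j, gbv_total D T p sigma j <= gbv_total D T p sigma g) ->
  n%:R * gbv_beta D T p <= gbv_total D T p sigma g.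
Proof.
move=> g_max; have m0 : (0 < m%:R :> R) by rewrite ltr0n (leq_ltn_trans _ (ltn_ord g)).
rewrite -(ler_pM2l m0) -(sum_gbv_total _ _ sigma).
apply: (@le_trans _ _ (\sum_(j < m) gbv_total D T p sigma g)).
  exact: ler_sum.
by rewrite sumr_const card_ord mulr_natl.
Qed.

End thresholds.

Arguments cutoff {R} D T p t.

(** * Order statistics of one voter's samples *)

Lemma ae_kth_largest_itv d (T : measurableType d) (R : realType)
    (P : probability T R) (D : probability R R) (m k : nat)
    (X : 'I_m -> {RV P >-> R}) :
  D [set x : R | 0 <= x <= 1] = 1%E -> (forall i, has_law P D (X i)) -> (k < m)%N ->
  {ae P, forall w, 0 <= kth_largest (fun i => X i w) k <= 1}.
Proof.
move=> D01 lawX km.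
have X01 i : {ae P, forall w, 0 <= X i w <= 1}.
  have m01 : measurable [set x : R | 0 <= x <= 1].
    suff <- : `[0, 1]%classic = [set x : R | 0 <= x <= 1] by [].
    by apply/seteqP; split=> x /=; rewrite in_itv.
  exists (X i @^-1` ~` [set x : R | 0 <= x <= 1]); split => //.
  - rewrite -[_ @^-1` _]setTI; apply: measurable_funPT => //; exact: measurableC.
  - by rewrite lawX; [rewrite probability_setC // D01 subee|exact: measurableC].
have : {ae P, forall w i, 0 <= X i w <= 1} by exact: filter_forall.
apply: filterS => w Xw.
(* The bound [k < m] makes [nth] return an actual sample instead of its default 0. *)
have : kth_largest (fun i => X i w) k \in [seq X i w | i <- enum 'I_m].
  rewrite /kth_largest -(mem_sort >=%R) mem_nth // size_sort size_map.
  by rewrite size_enum_ord.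
by move=> /mapP[i _ ->].
Qed.

(** The event says that at least [k.+1] samples reach [y]. Its probability is a binomial tail with
    failure probability at most [q], so [le_binom_tail] applies. *)
Lemma kth_largest_cutoff_prob d (T : measurableType d) (R : realType)
    (P : probability T R) (D : probability R R) (m k : nat)
    (X : 'I_m -> {RV P >-> R}) (y q : R) :
  mutually_independent P (fun i => X i : T -> R) ->
  (forall i, has_law P D (X i)) -> (k < m)%N ->
  1 - fine (D [set x : R | y <= x]) <= q -> q <= 1 ->
  ((binom_tail m q k.+1)%:E <= P [set w | (y <= kth_largest (fun i => X i w) k)%R])%E.
Proof.
move=> indX lawX km yq q1.
have mB : measurable [set x : R | y <= x] by apply: (@measurable_superlevel _ R R id).
have := @count_hits_law _ _ _ P D m k.+1 X _ indX lawX mB.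
have -> : [set w | (k < #|[set i | X i w \in [set x : R | (y <= x)%R]%classic]%SET|)%N] =
          [set w | y <= kth_largest (fun i => X i w) k].
  apply/seteqP; split=> w /=; rewrite le_kth_largest //.
    by congr (_ < _)%N; apply: eq_card => i; rewrite !inE; apply/asboolP/idP.
  by congr (_ < _)%N; apply: eq_card => i; rewrite !inE; apply/idP/asboolP.
move=> ->; rewrite lee_fin le_binom_tail // subr_ge0.
by rewrite -lee_fin fineK ?fin_num_measure // probability_le1.
Qed.

(** * Comparison of scores with expected welfare *)

Theorem theorem8 (R : realType) (D : probability R R)
  (T : nat) (p : nat -> R) (n m : nat)
  (dT : measure_display) (Omega : measurableType dT) (P : probability Omega R)
  (X : 'I_n * 'I_m -> {RV P >-> R})
  (sigma : 'I_n -> {perm 'I_m}) (g : 'I_m) :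
  D [set x : R | 0 <= x <= 1] = 1%E ->
  (1 <= T)%N ->
  0 < p 1%N ->
  (forall t, (1 <= t)%N -> (t < T)%N -> p t < p t.+1) ->
  p T <= 1 ->
  mutually_independent P (fun ik => (X ik : Omega -> R)) ->
  (forall ik, has_law P D (X ik)) ->
  (forall j, gbv_total D T p sigma j <= gbv_total D T p sigma g) ->
  forall j : 'I_m,
    ((gbv_beta D T p)%:E * 'E_P[sw (fun ik => (X ik : Omega -> R)) sigma j]
      <= 'E_P[sw (fun ik => (X ik : Omega -> R)) sigma g])%E.
Proof.
move=> D01 T_gt0 p1_gt0 p_incr pT_le1 indX lawX g_max j.
pose W := sw (fun ik => (X ik : Omega -> R)) sigma.
pose V (j : 'I_m) (i : 'I_n) w := kth_largest (fun k => X (i, k) w) (sigma i j).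
pose Q := cutoff D T p.
have Q_homo : {homo Q : s t / (s <= t)%N >-> (s <= t)%R} by exact: cutoff_homo.
have mV a i : measurable_fun setT (V a i).
  by apply: measurable_kth_largest => // k; exact: measurable_funPT.
have mW a : measurable_fun setT (W a) by apply: measurable_sum => i; exact: mV.
have V01 a : {ae P, forall w i, 0 <= V a i w <= 1}.
  apply: filter_forall => i.
  by apply: (@ae_kth_largest_itv _ _ _ P D m _ (fun k => X (i, k))).
have W_ge0 a : {ae P, forall w, 0 <= W a w}.
  by apply: filterS (V01 a) => w Vw; apply: sumr_ge0 => i _; case/andP: (Vw i).
have EW_le_n : ('E_P[W j] <= n%:R%:E)%E.
  rewrite -(expectation_cst P); apply: expectation_ae_le => //.
  apply: filterS (V01 j) => w Vw.
  rewrite -[n in leRHS]card_ord -sumr_const; apply: ler_sum => i _.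
  by case/andP: (Vw i).
apply: (@le_trans _ _ (gbv_beta D T p * n%:R)%:E).
  by rewrite EFinM lee_wpmul2l // lee_fin gbv_beta_ge0.
apply: (@le_trans _ _ (gbv_total D T p sigma g)%:E).
  by rewrite lee_fin mulrC gbv_total_max_ge.
(* A pair is a voter and a step: [A] is the event that her utility for [g] reaches the upper end of
   the step, and [c] is the height of the step. *)
pose A (x : 'I_n * 'I_T) := [set w | Q x.2.+1 <= V g x.1 w].
pose c (x : 'I_n * 'I_T) := Q x.2.+1 - Q x.2.
have mA x : measurable (A x) by exact: measurable_superlevel.
have c_ge0 x : 0 <= c x by rewrite subr_ge0 Q_homo.
apply: (@le_trans _ _ ('E_P[(fun w => \sum_x c x * \1_(A x) w)%R])%E).
  rewrite expectation_sum_indic // /gbv_total.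
  under eq_bigr do rewrite gbv_scoreE //.
  rewrite pair_bigA /= -sumEFin; apply: lee_sum => -[i t] _ /=.
  rewrite EFinM lee_wpmul2l ?lee_fin //; first exact: (c_ge0 (i, t)).
  apply: (@kth_largest_cutoff_prob _ _ _ P D m _ (fun k => X (i, k))) => //.
  (* The samples of voter [i] form the subfamily indexed by the pairs [(i, k)]. *)
  - by apply: (mutually_independent_inj _ _ _ _ _ _ _ (fun k : 'I_m => (i, k))) indX => k l [].
  - exact: cutoff_mass.
  - by have /andP[] := pext_bounds _ T p p1_gt0 p_incr pT_le1 t.
apply: expectation_ae_le => //.
- apply: measurable_sum => x; exact: measurable_funM.
- by apply: aeW => w; apply: sumr_ge0 => x _; rewrite mulr_ge0.
(* Pointwise, each voter's staircase lies below her utility for [g]. *)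
apply: filterS (V01 g) => w Vw; rewrite -(pair_bigA _ (fun i t => c (i, t) * \1_(A (i, t)) w)).
apply: ler_sum => i _ /=.
apply: le_trans (sum_steps_le _ Q (V g i w) T erefl Q_homo _); last by case/andP: (Vw i).
apply: ler_sum => t _; rewrite indicE.
by have -> : (w \in A (i, t)) = (Q t.+1 <= V g i w) by apply/idP/idP; rewrite inE.
Qed.
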